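(* Let $K=\overline{\mathbb Q}$. 1. All $28$ bitangents of the plane quartic $C_9: y^3z=x(x^3-z^3)$ in $\mathbb P^2_K$ have explicit symbolic solutions: each of them is a line $\alpha x+\beta y+\gamma z=0$ whose coefficients $\alpha,\beta,\gamma$ can be chosen expressible by radicals over $\mathbb Q$. 2. Let $r\in K$ be such that $0,1,r,1-r$ are pairwise distinct, and let $C_6(r)\subset\mathbb P^2_K$ be the plane quartic $y^3z=x(x-z)(x-rz)(x-(1-r)z)$. Then $C_6(r)$ has $3$ explicit horizontal bitangents (their coefficients being given symbolically in terms of $r$), and these three bitangents form an asyzygetic triple.
   Context: A line $L$ is a bitangent of a plane quartic $C$ if it is tangent to $C$ at two points $p_1,p_2$, counted with multiplicity (the two tangency points may coincide). Equivalently, the restriction to $L$ of the quartic form defining $C$ is the square of a quadratic form. A smooth plane quartic has $28$ bitangents. A bitangent is called horizontal if it has the form $by+z=0$ with $b\neq0$, i.e. in the affine chart $z=1$ it is a line $y=\text{const}$ (the bitangent $z=0$, which corresponds to $b=0$, is not counted as horizontal). Let $L_i,L_j,L_k$ be three distinct bitangents of $C$, with tangency points $p_{i_1},p_{i_2}$; $p_{j_1},p_{j_2}$; $p_{k_1},p_{k_2}$ respectively. The triple $L_i,L_j,L_k$ is called syzygetic if the six points $p_{i_1},p_{i_2},p_{j_1},p_{j_2},p_{k_1},p_{k_2}$ lie on a plane conic, and asyzygetic otherwise.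
   Formalization: In the definition of syzygetic, ''plane conic'' is restricted to irreducible conics; if line pairs count, the claim of part 2 fails for every r, since all six tangency points lie on x^2 - xz + (r(1-r)/2)z^2 = 0. *)

(* Defs.v *)
From HB Require Import structures.
From mathcomp Require Import all_boot all_order all_algebra all_field.
From mathcomp Require Import mpoly.

Set Implicit Arguments.
Unset Strict Implicit.
Unset Printing Implicit Defensive.

Import Order.TTheory GRing.Theory Num.Theory.
Local Open Scope ring_scope.

(* [algC] is MathComp's algebraic closure of [rat].  A point of P^2 is given by
   a nonzero vector v : 'rV[algC]_3 of homogeneous coordinates (x : y : z), and
   the line a x + b y + c z = 0 by the nonzero vector l = (a, b, c).  For row
   vectors u, v with v != 0, (u <= v)%MS says that u is a scalar multiple of v,
   and (u == v)%MS that u and v define the same point (or the same line). *)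

Definition lineval (l v : 'rV[algC]_3) : algC := \sum_i l 0 i * v 0 i.

Definition formval (F : {mpoly algC[3]}) (v : 'rV[algC]_3) : algC :=
  F.@[fun i => v 0 i].

(* The line l is tangent to the quartic F = 0 at p1 and p2, possibly p1 = p2:
   the divisor cut out on l by F is 2 p1 + 2 p2.  The restriction of m_k to l is
   a binary linear form whose only zero is p_k; leading constants are absorbed
   into the m_k. *)
Definition bitangent_at (F : {mpoly algC[3]}) (l p1 p2 : 'rV[algC]_3) : Prop :=
  [/\ l != 0,
      p1 != 0 /\ lineval l p1 = 0,
      p2 != 0 /\ lineval l p2 = 0 &
      exists m1 m2 : 'rV[algC]_3,
        forall v : 'rV[algC]_3, lineval l v = 0 ->
          [/\ lineval m1 v = 0 <-> (v <= p1)%MS,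
              lineval m2 v = 0 <-> (v <= p2)%MS &
              formval F v = (lineval m1 v * lineval m2 v) ^+ 2]].

Definition bitangent (F : {mpoly algC[3]}) (l : 'rV[algC]_3) : Prop :=
  exists p1 p2 : 'rV[algC]_3, bitangent_at F l p1 p2.

Definition distinct_lines (n : nat) (L : 'I_n -> 'rV[algC]_3) : Prop :=
  forall i j : 'I_n, i != j -> ~~ (L i == L j)%MS.

Definition hline (b : algC) : 'rV[algC]_3 :=
  \row_(j < 3) [:: 0; b; 1]`_j.

Definition horizontal (l : 'rV[algC]_3) : Prop :=
  exists2 b : algC, b != 0 & (l == hline b)%MS.

(* Conics are irreducible (equivalently, over an algebraically closed field,
   smooth) plane curves of degree 2; pairs of lines are not conics here, so
   three distinct collinear points never lie on a conic.  This matters: if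
   pairs of lines were admitted, the triple of horizontal bitangents of [C6 r]
   below would be syzygetic, all its tangency points being zeros of
   x^2 - x z + (r (1 - r) / 2) z^2, a product of two linear forms. *)
Definition conic (Q : {mpoly algC[3]}) : Prop :=
  [/\ Q != 0, Q \is 2.-homog &
      forall A B : {mpoly algC[3]},
        Q = A * B -> (msize A <= 1)%N \/ (msize B <= 1)%N].

Definition syzygetic (F : {mpoly algC[3]}) (L : 'I_3 -> 'rV[algC]_3) : Prop :=
  [/\ forall i, bitangent F (L i),
      distinct_lines L &
      exists p1 p2 : 'I_3 -> 'rV[algC]_3,
        (forall i, bitangent_at F (L i) (p1 i) (p2 i)) /\
        exists2 Q : {mpoly algC[3]}, conic Q &
          forall i, formval Q (p1 i) = 0 /\ formval Q (p2 i) = 0].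

Definition asyzygetic (F : {mpoly algC[3]}) (L : 'I_3 -> 'rV[algC]_3) : Prop :=
  [/\ forall i, bitangent F (L i), distinct_lines L & ~ syzygetic F L].

Definition X : {mpoly algC[3]} := 'X_(0 : 'I_3).
Definition Y : {mpoly algC[3]} := 'X_(1 : 'I_3).
Definition Z : {mpoly algC[3]} := 'X_(2 : 'I_3).

Definition C9 : {mpoly algC[3]} := Y ^+ 3 * Z - X * (X ^+ 3 - Z ^+ 3).

Definition C6 (r : algC) : {mpoly algC[3]} :=
  Y ^+ 3 * Z - X * (X - Z) * (X - r *: Z) * (X - (1 - r) *: Z).

(* Symbolic expressions in radicals over Q, with indeterminates indexed by V.
   [RRoot n e] is evaluated with the fixed choice of root [n.-root]; no value is
   lost, since the other n-th roots are its products with powers of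
   (n.-root (-1)) ^+ 2, a primitive n-th root of unity. *)
Inductive radexpr (V : Type) : Type :=
| RVar of V
| RRat of rat
| RAdd of radexpr V & radexpr V
| ROpp of radexpr V
| RMul of radexpr V & radexpr V
| RInv of radexpr V
| RRoot of nat & radexpr V.

Fixpoint radeval (V : Type) (env : V -> algC) (e : radexpr V) : algC :=
  match e with
  | RVar v => env v
  | RRat q => ratr q
  | RAdd e1 e2 => radeval env e1 + radeval env e2
  | ROpp e1 => - radeval env e1
  | RMul e1 e2 => radeval env e1 * radeval env e2
  | RInv e1 => (radeval env e1)^-1
  | RRoot n e1 => n.-root (radeval env e1)
  end.

Definition radval (e : radexpr void) : algC :=
  radeval (of_void algC) e.

Definition radval_at (r : algC) (e : radexpr unit) : algC :=
  radeval (fun=> r) e.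

(* Main.v *)
Require Import Defs.
From HB Require Import structures.
From mathcomp Require Import all_boot all_order all_algebra all_field.
From mathcomp Require Import mpoly.
From mathcomp Require Import ring.

Set Implicit Arguments.
Unset Strict Implicit.
Unset Printing Implicit Defensive.

Import Order.TTheory GRing.Theory Num.Theory.
Local Open Scope ring_scope.

(** Both curves have the form y^3 z = f(x, z) with f a binary quartic form,
    monic in x.  A line that is a graph y = m x + n z is therefore a bitangent
    exactly when (m x + n)^3 - f(x, 1) equals - (x^2 + p x + q)^2 for some p
    and q, which is a system of four polynomial equations in m, n, p, q
    ([graph_bitangentP]).

    For y^3 z = x (x^3 - z^3) one eliminates p and q and puts n = k m^4, the
    weights being dictated by the automorphisms (x : y : z) -> (w^3 x : w y : z),
    w^9 = 1.  What remains is a cubic equation for k and an equation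
    m^9 = const(k).  With k = - (v + 1)^2 / 4 the cubic becomes
    v^3 = 3 v + 1, whose roots are w + 1 / w for the primitive 18th roots of
    unity w, and m^9 = 16 (94 + 12 v - 33 v^2) ([C9_monic_squareP]).  The three
    values of v and the nine ninth roots m give 27 bitangents; the only other
    one is z = 0, since no line x = c z is a bitangent ([C9_vertical]).

    For the second family put s = r (1 - r).  On y = n z the quartic restricts
    to - (u^2 + s u - n^3) with u = x^2 - x, so that the line is a bitangent
    iff n^3 = - s^2 / 4, that is, iff b = - 1 / n satisfies b^3 = 4 / s^2.  All
    three lines have the same abscissae of tangency, the roots of
    x^2 - x + s / 2.  If a is one of them, the line x = a z contains three
    tangency points, and a conic through three collinear points contains the
    line ([conic_collinear]); hence the triple is asyzygetic. *)

(** * Coordinates in the projective plane *)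

(** The row vector of homogeneous coordinates (x : y : z). *)
Definition pt (x y z : algC) : 'rV[algC]_3 := \row_(j < 3) [:: x; y; z]`_j.

Arguments pt (x y z)%_R.

Lemma pt0 x y z : pt x y z 0 0 = x. Proof. by rewrite mxE. Qed.
Lemma pt1 x y z : pt x y z 0 1 = y. Proof. by rewrite mxE. Qed.
Lemma pt2 x y z : pt x y z 0 2 = z. Proof. by rewrite mxE. Qed.
Definition ptE := (pt0, pt1, pt2).

Lemma ord3P (P : 'I_3 -> Prop) : P 0 -> P 1 -> P 2 -> forall i, P i.
Proof.
move=> P0 P1 P2 [[|[|[|//]]] lti].
- by have -> : Ordinal lti = 0 by apply: val_inj.
- by have -> : Ordinal lti = 1 by apply: val_inj.
- by have -> : Ordinal lti = 2 by apply: val_inj.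
Qed.

Lemma row3P (u v : 'rV[algC]_3) :
  u 0 0 = v 0 0 -> u 0 1 = v 0 1 -> u 0 2 = v 0 2 -> u = v.
Proof. by move=> e0 e1 e2; apply/rowP; apply: ord3P. Qed.

Lemma pt_coords (v : 'rV[algC]_3) : v = pt (v 0 0) (v 0 1) (v 0 2).
Proof. by apply: row3P; rewrite ptE. Qed.

Lemma scale_pt c x y z : c *: pt x y z = pt (c * x) (c * y) (c * z).
Proof. by apply: row3P; rewrite mxE !ptE. Qed.

Lemma big_ord3 (R : nmodType) (f : 'I_3 -> R) : \sum_i f i = f 0 + f 1 + f 2.
Proof.
rewrite !big_ord_recl big_ord0 addr0 addrA.
by congr (_ + f _ + f _); apply: val_inj.
Qed.

Lemma linevalE l v :
  lineval l v = l 0 0 * v 0 0 + l 0 1 * v 0 1 + l 0 2 * v 0 2.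
Proof. exact: big_ord3. Qed.

Lemma same_lineP (u v : 'rV[algC]_3) : u != 0 ->
  (u == v)%MS -> exists2 c, c != 0 & u = c *: v.
Proof.
move=> u_neq0 /andP[/sub_rVP[c uE] _]; exists c => //.
by apply: contraNneq u_neq0 => c0; rewrite uE c0 scale0r.
Qed.

Lemma same_line_scale c (v : 'rV[algC]_3) : c != 0 -> (c *: v == v)%MS.
Proof. by move=> c_neq0; apply/eqmxP/eqmx_scale. Qed.

Lemma formval_pt F x y z :
  formval F (pt x y z) = F.@[fun i : 'I_3 => [:: x; y; z]`_i].
Proof. by apply: meval_eq => i; rewrite mxE. Qed.

(** * Bitangents that are graphs *)

Lemma quad_split (p q : algC) : exists a b : algC, a + b = - p /\ a * b = q.
Proof.
pose d := sqrtC (p ^+ 2 - 4%:R * q).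
have dE : d ^+ 2 = p ^+ 2 - 4%:R * q by exact: sqrtCK.
exists ((- p + d) / 2%:R), ((- p - d) / 2%:R); split; first by field.
have -> : (- p + d) / 2%:R * ((- p - d) / 2%:R) = (p ^+ 2 - d ^+ 2) / 4%:R by field.
by rewrite dE; field.
Qed.

(** A polynomial of degree at most 4 that vanishes identically is zero. *)
Lemma quartic_coef0 (c0 c1 c2 c3 c4 : algC) :
  (forall x, c4 * x ^+ 4 + c3 * x ^+ 3 + c2 * x ^+ 2 + c1 * x + c0 = 0) ->
  [/\ c0 = 0, c1 = 0, c2 = 0, c3 = 0 & c4 = 0].
Proof.
move=> f0; pose p := Poly [:: c0; c1; c2; c3; c4].
have hp x : p.[x] = 0 by rewrite horner_Poly /= -[RHS](f0 x); ring.
have p0 : p = 0.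
  apply/eqP; apply: contraT => p_neq0.
  pose s : seq algC := [seq i%:R | i <- iota 0 (size p)].
  have := max_poly_roots p_neq0 (rs := s).
  rewrite size_map size_iota ltnn; apply.
    by apply/allP => x _; rewrite rootE hp.
  by rewrite map_inj_uniq ?iota_uniq // => i j /eqP; rewrite eqr_nat => /eqP.
have c_ i : [:: c0; c1; c2; c3; c4]`_i = 0 by rewrite -coef_Poly -/p p0 coef0.
by split; [exact: (c_ 0) | exact: (c_ 1%N) | exact: (c_ 2%N) | exact: (c_ 3%N)
  | exact: (c_ 4%N)].
Qed.

(** The quartic x^4 + c3 x^3 + c2 x^2 + c1 x + c0 is the square of
    x^2 + p x + q for some p and q. *)
Definition monic_square (c3 c2 c1 c0 : algC) : Prop :=
  exists p q : algC, [/\ c3 = 2%:R * p, c2 = p ^+ 2 + 2%:R * q, c1 = 2%:R * p * q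
                & c0 = q ^+ 2].

(** A line with l 0 1 != 0 is the graph y = m x + n z, where m and n are given
    by the equations on its coefficients. *)
Lemma graph_lineP (l v : 'rV[algC]_3) (m n : algC) : l 0 1 != 0 ->
  l 0 0 = - m * l 0 1 -> l 0 2 = - n * l 0 1 ->
  lineval l v = 0 <-> v 0 1 = m * v 0 0 + n * v 0 2.
Proof.
move=> l1 l0E l2E; rewrite linevalE l0E l2E.
have -> : - m * l 0 1 * v 0 0 + l 0 1 * v 0 1 + - n * l 0 1 * v 0 2 =
  l 0 1 * (v 0 1 - (m * v 0 0 + n * v 0 2)) by ring.
split=> [/eqP|->]; last by rewrite subrr mulr0.
by rewrite mulf_eq0 (negPf l1) /= subr_eq0 => /eqP.
Qed.

(** The graph y = m x + n z is a bitangent iff F restricts to it as minus the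
    square of a monic quadratic form.  The sign comes from the term - x^4; it is
    absorbed by the square of the imaginary unit in one linear form. *)
Lemma graph_bitangentP F (l : 'rV[algC]_3) (m n c3 c2 c1 c0 : algC) : l 0 1 != 0 ->
    l 0 0 = - m * l 0 1 -> l 0 2 = - n * l 0 1 ->
    (forall x z, formval F (pt x (m * x + n * z) z) =
      - (x ^+ 4 + c3 * x ^+ 3 * z + c2 * x ^+ 2 * z ^+ 2 + c1 * x * z ^+ 3
         + c0 * z ^+ 4)) ->
  bitangent F l <-> monic_square c3 c2 c1 c0.
Proof.
move=> l1 l0E l2E FE; have lP v := graph_lineP v l1 l0E l2E; split.
- case=> p1 [p2 [_ _ _ [m1 [m2 m12]]]].
  (* the two linear forms, written in the coordinates x, z of the line *)
  pose a1 := m1 0 0 + m1 0 1 * m; pose b1 := m1 0 2 + m1 0 1 * n.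
  pose a2 := m2 0 0 + m2 0 1 * m; pose b2 := m2 0 2 + m2 0 1 * n.
  pose A := a1 * a2; pose B := a1 * b2 + b1 * a2; pose C := b1 * b2.
  have sqE x : A ^+ 2 * x ^+ 4 + 2%:R * A * B * x ^+ 3
     + (B ^+ 2 + 2%:R * A * C) * x ^+ 2 + 2%:R * B * C * x + C ^+ 2
     = - (x ^+ 4 + c3 * x ^+ 3 + c2 * x ^+ 2 + c1 * x + c0).
    have /m12[_ _] : lineval l (pt x (m * x + n * 1) 1) = 0.
      by apply/lP; rewrite !ptE.
    rewrite FE !linevalE !ptE !expr1n !mulr1 => ->.
    by rewrite /A /B /C /a1 /a2 /b1 /b2; ring.
  have [e0 e1 e2 e3 e4] : [/\ C ^+ 2 + c0 = 0, 2%:R * B * C + c1 = 0,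
      B ^+ 2 + 2%:R * A * C + c2 = 0, 2%:R * A * B + c3 = 0 & A ^+ 2 + 1 = 0].
    apply: quartic_coef0 => x; apply/eqP; rewrite -subr_eq0 subr0; apply/eqP.
    have /eqP := sqE x; rewrite -subr_eq0 => /eqP sq0.
    by rewrite -[RHS]sq0; ring.
  have {e4} AE : A * A = -1 by apply/eqP; rewrite -addr_eq0 -expr2 e4.
  (* since A^2 = -1, dividing by A is multiplying by - A *)
  exists (- A * B), (- A * C); split.
  + by apply/eqP; rewrite -subr_eq0 -[X in _ == X]e3; apply/eqP; ring.
  + apply/eqP; rewrite -subr_eq0 -[X in _ == X]e2; apply/eqP.
    have -> : (- A * B) ^+ 2 = A * A * B ^+ 2 by ring.
    by rewrite AE; ring.
  + apply/eqP; rewrite -subr_eq0 -[X in _ == X]e1; apply/eqP.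
    have -> : 2%:R * (- A * B) * (- A * C) = A * A * (2%:R * B * C) by ring.
    by rewrite AE; ring.
  + apply/eqP; rewrite -subr_eq0 -[X in _ == X]e0; apply/eqP.
    have -> : (- A * C) ^+ 2 = A * A * C ^+ 2 by ring.
    by rewrite AE; ring.
- case=> p [q [c3E c2E c1E c0E]].
  have [a [b [abD abM]]] := quad_split p q.
  have pE : p = - (a + b) by rewrite abD opprK.
  have iE : 'i * 'i = -1 :> algC by rewrite -expr2 sqrCi.
  have neq0 x y : pt x y 1 != 0.
    by apply/eqP => /rowP/(_ 2)/eqP; rewrite ptE mxE oner_eq0.
  exists (pt a (m * a + n) 1), (pt b (m * b + n) 1); split.
  + by apply: contraNneq l1 => ->; rewrite mxE.
  + by split=> //; apply/lP; rewrite !ptE mulr1.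
  + by split=> //; apply/lP; rewrite !ptE mulr1.
  have ptP (c k : algC) v : k != 0 -> lineval l v = 0 ->
      k * v 0 0 + 0 * v 0 1 + - k * c * v 0 2 = 0
        <-> (v <= pt c (m * c + n) 1)%MS.
    move=> k0 /lP vE; split=> [/eqP|/sub_rVP[d vd]]; last first.
      by rewrite vd !mxE /=; ring.
    have -> : k * v 0 0 + 0 * v 0 1 + - k * c * v 0 2 = k * (v 0 0 - c * v 0 2).
      by ring.
    rewrite mulf_eq0 (negPf k0) /= subr_eq0 => /eqP v0E.
    apply/sub_rVP; exists (v 0 2).
    by apply: row3P; rewrite mxE ptE ?vE ?[v 0 0 in LHS]v0E; ring: v0E.
  exists (pt 'i 0 (- 'i * a)), (pt 1 0 (- 1 * b)) => v lv; split.
  + by rewrite linevalE !ptE; apply: ptP lv; rewrite neq0Ci.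
  + by rewrite linevalE !ptE; apply: ptP lv; rewrite oner_eq0.
  rewrite (pt_coords v); move/lP: lv => ->; rewrite FE !linevalE !ptE.
  rewrite c3E c2E c1E c0E pE -abM.
  set x := v 0 0; set z := v 0 2.
  have -> : (('i * x + 0 * (m * x + n * z) + - 'i * a * z) *
    (1 * x + 0 * (m * x + n * z) + - 1 * b * z)) ^+ 2 =
    'i * 'i * ((x - a * z) * (x - b * z)) ^+ 2 by ring.
  by rewrite iE; ring.
Qed.

(** * Radical expressions for roots of unity *)

(** The expression for the n-th power of e. *)
Definition rpow (V : Type) (e : radexpr V) (n : nat) : radexpr V :=
  iter n (fun e' => RMul e' e) (RRat V 1).

Lemma radeval_rpow V env (e : radexpr V) n :
  radeval env (rpow e n) = radeval env e ^+ n.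
Proof.
elim: n => [|n IHn] /=; first by rewrite rmorph1 expr0.
by rewrite exprSr -IHn.
Qed.

Lemma radevalD V (env : V -> algC) e1 e2 :
  radeval env (RAdd e1 e2) = radeval env e1 + radeval env e2.
Proof. by []. Qed.

Lemma radevalM V (env : V -> algC) e1 e2 :
  radeval env (RMul e1 e2) = radeval env e1 * radeval env e2.
Proof. by []. Qed.

Lemma radevalN V (env : V -> algC) e : radeval env (ROpp e) = - radeval env e.
Proof. by []. Qed.

Lemma radevalV V (env : V -> algC) e : radeval env (RInv e) = (radeval env e)^-1.
Proof. by []. Qed.

Lemma radeval_root V (env : V -> algC) n e :
  radeval env (RRoot n e) = n.-root (radeval env e).
Proof. by []. Qed.

Lemma radeval_nat V (env : V -> algC) n : radeval env (RRat V n%:R) = n%:R.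
Proof. exact: ratr_nat. Qed.

(** The cube root of (1 + sqrt (- 3)) / 2, a primitive 6th root of unity; it is
    a primitive 18th root of unity whichever of the roots are chosen. *)
Definition zeta : algC := 3.-root (2%:R^-1 * (1 + 2.-root (- 3%:R))).

Definition zetaE (V : Type) : radexpr V :=
  RRoot 3 (RMul (RRat V 2%:R^-1) (RAdd (RRat V 1) (RRoot 2 (RRat V (- 3%:R))))).

Lemma radeval_zetaE V (env : V -> algC) : radeval env (zetaE V) = zeta.
Proof.
have r2 : ratr 2%:R^-1 = 2%:R^-1 :> algC by rewrite fmorphV rmorph_nat.
have r3 : ratr (- 3%:R) = - 3%:R :> algC by rewrite rmorphN rmorph_nat.
have r1 : ratr 1 = 1 :> algC by rewrite rmorph1.
by rewrite /zetaE /radeval -/radeval r1 r2 r3.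
Qed.

Lemma zeta6 : zeta ^+ 6 = zeta ^+ 3 - 1.
Proof.
have z3 : zeta ^+ 3 = 2%:R^-1 * (1 + 2.-root (- 3%:R)) by exact: rootCK.
have d2 : 2.-root (- 3%:R) ^+ 2 = - 3%:R :> algC by exact: rootCK.
rewrite (exprM zeta 3 2) z3; set d := 2.-root _ in d2 *.
have -> : (2%:R^-1 * (1 + d)) ^+ 2 = (1 + 2%:R * d + d ^+ 2) / 4%:R by field.
by rewrite d2; field.
Qed.

Lemma zeta_prim : 18.-primitive_root zeta.
Proof.
have z6 := zeta6.
have z18 : zeta ^+ 18 = 1 by ring: z6.
have [n zn n18] := prim_order_exists (isT : (0 < 18)%N) z18.
have dvd := prim_order_dvd zn.
(* a proper divisor of 18 divides 6 or 9 *)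
have n6 : ~~ (n %| 6)%N.
  rewrite dvd; apply/eqP => z6_1.
  have z3 : zeta ^+ 3 = 2%:R.
    apply/eqP; rewrite -subr_eq0 -[X in _ == X](subrr 1) -{2}z6_1 z6.
    by apply/eqP; ring.
  have /eqP := z6_1; rewrite (exprM zeta 3 2) z3 -natrX pnatr_eq1.
  by [].
have n9 : ~~ (n %| 9)%N.
  have -> : (n %| 9)%N = (zeta ^+ 9 == 1) by rewrite dvd.
  have -> : zeta ^+ 9 = -1 by ring: z6.
  by rewrite eqNr oner_eq0.
have : n \in divisors 18 by rewrite -dvdn_divisors.
have -> : divisors 18 = [:: 1; 2; 3; 6; 9; 18]%N by [].
rewrite !inE => nE; move: zn n6 n9.
by repeat (case/orP: nE => [/eqP -> //|nE]); move/eqP: nE => ->.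
Qed.

Lemma zeta_neq0 : zeta != 0.
Proof.
have := expf_eq0 zeta 18; rewrite (prim_expr_order zeta_prim) oner_eq0 /=.
by move=> <-.
Qed.

Lemma zeta2_prim : 9.-primitive_root (zeta ^+ 2).
Proof. exact: (dvdn_prim_root zeta_prim (isT : (9 %| 18)%N)). Qed.

Lemma zeta6_prim : 3.-primitive_root (zeta ^+ 6).
Proof. exact: (dvdn_prim_root zeta_prim (isT : (3 %| 18)%N)). Qed.

Lemma same_power_prim (F : fieldType) n (w x y : F) : n.-primitive_root w ->
  y != 0 -> x ^+ n = y ^+ n -> exists2 i : nat, (i < n)%N & x = y * w ^+ i.
Proof.
move=> wP y0 xyn; have [|[i ltin] /= iE] := prim_rootP wP (x := x / y).
  by rewrite expr_div_n xyn divff // expf_neq0.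
by exists i => //; rewrite -iE mulrC divfK.
Qed.

Lemma prim_mul_inj (F : fieldType) n (w y : F) i j : n.-primitive_root w ->
  y != 0 -> (i < n)%N -> (j < n)%N -> y * w ^+ i = y * w ^+ j -> i = j.
Proof.
move=> wP y0 lti ltj /(mulfI y0)/eqP; rewrite (eq_prim_root_expr wP).
by rewrite !modn_small // => /eqP.
Qed.

(** For a = 0, 1, 2, the number w + 1 / w with w = zeta ^+ (1 + 6 a); since
    zeta ^+ 18 = 1, the inverse of w is zeta ^+ (17 - 6 a). *)
Definition nu (a : nat) : algC := zeta ^+ (1 + 6 * a) + zeta ^+ (17 - 6 * a).

Definition nuE (V : Type) (a : nat) : radexpr V :=
  RAdd (rpow (zetaE V) (1 + 6 * a)) (rpow (zetaE V) (17 - 6 * a)).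

Lemma radeval_nuE V (env : V -> algC) a : radeval env (nuE V a) = nu a.
Proof.
by rewrite radevalD !radeval_rpow radeval_zetaE.
Qed.

(** The same numbers in the basis 1, zeta, ..., zeta^5, by zeta^6 = zeta^3 - 1. *)
Lemma nu_reduced : [/\ nu 0 = zeta + zeta ^+ 2 - zeta ^+ 5,
  nu 1 = zeta ^+ 4 - zeta - zeta ^+ 2 & nu 2 = zeta ^+ 5 - zeta ^+ 4].
Proof.
by have z6 := zeta6; rewrite /nu; split; rewrite ?muln0 ?muln1 /=; ring: z6.
Qed.

(** The roots of T^3 - 3 T - 1, by the triple angle formula for w + 1 / w, where
    w^3 is a primitive 6th root of unity. *)
Lemma nu_roots x : x ^+ 3 = 3%:R * x + 1 <-> exists2 a, (a < 3)%N & x = nu a.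
Proof.
have z6 := zeta6; have [n0 n1 n2] := nu_reduced.
have fE : x ^+ 3 - (3%:R * x + 1) = (x - nu 0) * (x - nu 1) * (x - nu 2).
  by rewrite n0 n1 n2; ring: z6.
have fP : x ^+ 3 = 3%:R * x + 1 <-> (x - nu 0) * (x - nu 1) * (x - nu 2) = 0.
  by rewrite -fE; split=> [->|/eqP]; [rewrite subrr | rewrite subr_eq0 => /eqP].
rewrite fP; split=> [/eqP|[[|[|[|//]]] _ ->]]; last 3 first.
- by rewrite subrr !mul0r.
- by rewrite subrr mulr0 mul0r.
- by rewrite subrr mulr0.
rewrite !mulf_eq0 !subr_eq0 => /orP[/orP[]|] /eqP ->.
- by exists 0%N.
- by exists 1%N.
- by exists 2%N.
Qed.

Lemma nu_inj a b : (a < 3)%N -> (b < 3)%N -> nu a = nu b -> a = b.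
Proof.
have z6 := zeta6; have [n0 n1 n2] := nu_reduced.
(* the discriminant of T^3 - 3T - 1 is 9^2 *)
have : (nu 0 - nu 1) * (nu 0 - nu 2) * (nu 1 - nu 2) != 0.
  have -> : (nu 0 - nu 1) * (nu 0 - nu 2) * (nu 1 - nu 2) = - 9%:R.
    by rewrite n0 n1 n2; ring: z6.
  by rewrite oppr_eq0 pnatr_eq0.
rewrite !mulf_eq0 !subr_eq0 !negb_or => /andP[/andP[/eqP n01 /eqP n02] /eqP n12].
case: a b => [|[|[|//]]] [|[|[|//]]] // _ _ e.
all: by [case: n01; rewrite e | case: n02; rewrite e | case: n12; rewrite e].
Qed.

(** * The bitangents of y^3 z = x (x^3 - z^3) *)

(** The ninth power of the slope of a bitangent attached to the root v of
    T^3 - 3 T - 1. *)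
Definition ninth (v : algC) : algC :=
  16%:R * (94%:R + 12%:R * v - 33%:R * v ^+ 2).

(** The quartic x^4 - x - (m x + n)^3 is a square iff (m, n) is one of the 27
    solutions attached to the roots v of T^3 - 3 T - 1. *)
Lemma C9_monic_squareP (m n : algC) :
  monic_square (- m ^+ 3) (- (3%:R * m ^+ 2 * n)) (- (3%:R * m * n ^+ 2 + 1))
    (- n ^+ 3)
  <-> exists v, [/\ v ^+ 3 = 3%:R * v + 1, m ^+ 9 = ninth v
                  & n = - (v + 1) ^+ 2 / 4%:R * m ^+ 4].
Proof.
split=> [[p [q [e3 e2 e1 e0]]]|[v [v3 m9 ->]]]; last first.
  (* p and q as forced by the coefficients of x^3 and x^2 *)
  exists (- m ^+ 3 / 2%:R), ((3%:R * (v + 1) ^+ 2 - 1) * m ^+ 6 / 8%:R).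
  split; [by field | by field | | by field: v3].
  by rewrite /ninth in m9; field: v3 m9.
have pE : p = - m ^+ 3 / 2%:R by rewrite e3; field.
have m0 : m != 0.
  (* for m = 0 the coefficient of x would be - 1 = 0 *)
  apply: contraTneq isT => m0; move/eqP: e1; rewrite pE m0 expr0n /=.
  by rewrite oppr0 !(mulr0, mul0r) add0r oppr_eq0 oner_eq0.
pose k := n / m ^+ 4.
have nE : n = k * m ^+ 4 by rewrite /k divfK // expf_neq0.
have qE : q = - (m ^+ 6 * (12%:R * k + 1)) / 8%:R.
  have -> : q = (p ^+ 2 + 2%:R * q - p ^+ 2) / 2%:R by field.
  by rewrite -e2 pE nE; field.
have kE : 64%:R * k ^+ 3 + (12%:R * k + 1) ^+ 2 = 0.
  apply: (mulfI (expf_neq0 12 m0)); rewrite mulr0.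
  have -> : m ^+ 12 * (64%:R * k ^+ 3 + (12%:R * k + 1) ^+ 2) =
    64%:R * (q ^+ 2 - - n ^+ 3) by rewrite qE nE; field.
  by rewrite e0 subrr mulr0.
have m9 : m ^+ 9 * (24%:R * k ^+ 2 + 12%:R * k + 1) = - 8%:R.
  have -> : m ^+ 9 * (24%:R * k ^+ 2 + 12%:R * k + 1) =
    8%:R * (2%:R * p * q - - (3%:R * m * n ^+ 2 + 1)) - 8%:R.
    by rewrite pE qE nE; field.
  by rewrite e1 subrr mulr0 sub0r.
pose v := 2%:R - (16%:R * k ^+ 2 + 36%:R * k + 6%:R).
(* 1 / (v - 2) = 4 k *)
have kv : 4%:R * k * (v - 2%:R) = 1.
  rewrite -[RHS](subr0 1) -kE /v; ring.
have v3 : v ^+ 3 = 3%:R * v + 1.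
  apply/eqP; rewrite -subr_eq0 -[X in _ == X](mul0r ((v - 2%:R) ^+ 3)) -kE.
  apply/eqP; have -> : (64%:R * k ^+ 3 + (12%:R * k + 1) ^+ 2) * (v - 2%:R) ^+ 3
    = (4%:R * k * (v - 2%:R)) ^+ 3
    + 9%:R * (4%:R * k * (v - 2%:R)) ^+ 2 * (v - 2%:R)
    + 6%:R * (4%:R * k * (v - 2%:R)) * (v - 2%:R) ^+ 2 + (v - 2%:R) ^+ 3 by ring.
  by rewrite kv; ring.
have kE' : k = - (v + 1) ^+ 2 / 4%:R.
  have vi : (v - 2%:R) * - (v + 1) ^+ 2 = 1 by ring: v3.
  have -> : k = 4%:R * k * ((v - 2%:R) * - (v + 1) ^+ 2) / 4%:R.
    by rewrite vi; field.
  by rewrite mulrA kv mul1r.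
exists v; split=> //; last by rewrite nE {1}kE'.
(* the cofactor of m^9 is half of a unit of Z[v] *)
have -> : m ^+ 9 = m ^+ 9 * (24%:R * k ^+ 2 + 12%:R * k + 1) * (- ninth v / 8%:R).
  by rewrite kE' /ninth; field: v3.
by rewrite m9; field.
Qed.

(** The second factor of [ninth] is a unit of Z[v]. *)
Lemma ninth_neq0 v : v ^+ 3 = 3%:R * v + 1 -> ninth v != 0.
Proof.
move=> v3; have : ninth v * (21%:R * v ^+ 2 + 39%:R * v + 11%:R) = - 16%:R.
  by rewrite /ninth; ring: v3.
by apply: contra_eqN => /eqP ->; rewrite mul0r eq_sym oppr_eq0 pnatr_eq0.
Qed.

(** The bitangents other than z = 0 are y = slope a b * x + intercept a b * z for
    a < 3 and b < 9: a selects the root of T^3 - 3 T - 1, and b the ninth root. *)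
Definition slope (a b : nat) : algC :=
  9.-root (ninth (nu a)) * (zeta ^+ 2) ^+ b.

Definition intercept (a b : nat) : algC :=
  - (nu a + 1) ^+ 2 / 4%:R * slope a b ^+ 4.

Lemma formval_C9 (m n x z : algC) : formval C9 (pt x (m * x + n * z) z) =
  - (x ^+ 4 + - m ^+ 3 * x ^+ 3 * z + - (3%:R * m ^+ 2 * n) * x ^+ 2 * z ^+ 2
     + - (3%:R * m * n ^+ 2 + 1) * x * z ^+ 3 + - n ^+ 3 * z ^+ 4).
Proof.
rewrite /formval /C9 /X /Y /Z !(mevalB, mevalM, rmorphXn, mevalXU) !ptE; ring.
Qed.

Lemma C9_graph_bitangentP (l : 'rV[algC]_3) : l 0 1 != 0 ->
  bitangent C9 l <->
  exists a b, [/\ (a < 3)%N, (b < 9)%N &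
    l = - l 0 1 *: pt (slope a b) (-1) (intercept a b)].
Proof.
move=> l1; pose m := - l 0 0 / l 0 1; pose n := - l 0 2 / l 0 1.
have l0E : l 0 0 = - m * l 0 1 by rewrite /m; field.
have l2E : l 0 2 = - n * l 0 1 by rewrite /n; field.
rewrite (graph_bitangentP l1 l0E l2E (formval_C9 m n)) C9_monic_squareP.
split=> [[v [/nu_roots[a lta ->] m9 nE]]|[a [b [lta ltb lE]]]].
- have [||b ltb mE] := same_power_prim zeta2_prim
    (y := 9.-root (ninth (nu a))) (x := m).
  + by rewrite rootC_eq0 // ninth_neq0 //; apply/nu_roots; exists a.
  + by rewrite rootCK.
  have {}mE : m = slope a b := mE.
  exists a, b; split=> //; apply: row3P; rewrite mxE ptE ?l0E ?l2E.
  + by rewrite -mE; ring.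
  + by ring.
  + by rewrite /intercept -mE -nE; ring.
- have mE : m = slope a b by rewrite /m {1}lE mxE ptE; field.
  have nE : n = intercept a b by rewrite /n {1}lE mxE ptE; field.
  exists (nu a); split; first by apply/nu_roots; exists a.
    by rewrite mE /slope exprMn rootCK // (exprAC (zeta ^+ 2))
      (prim_expr_order zeta2_prim) expr1n mulr1.
  by rewrite nE /intercept mE.
Qed.

Lemma C9_line_at_infinity : bitangent C9 (pt 0 0 1).
Proof.
have iE : 'i * 'i = -1 :> algC by rewrite -expr2 sqrCi.
have lP v : lineval (pt 0 0 1) v = 0 -> v 0 2 = 0.
  by rewrite linevalE !ptE !mul0r mul1r !add0r.
have p_neq0 : pt 0 1 0 != 0.
  by apply/eqP => /rowP/(_ 1)/eqP; rewrite ptE mxE oner_eq0.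
have ptP (k : algC) v : k != 0 -> lineval (pt 0 0 1) v = 0 ->
    lineval (pt k 0 0) v = 0 <-> (v <= pt 0 1 0)%MS.
  move=> k0 /lP v2; rewrite linevalE !ptE !mul0r !addr0.
  split=> [/eqP|/sub_rVP[d ->]]; last by rewrite mxE ptE !mulr0.
  rewrite mulf_eq0 (negPf k0) /= => /eqP v0; apply/sub_rVP; exists (v 0 1).
  by apply: row3P; rewrite mxE ptE ?v0 ?v2; ring.
exists (pt 0 1 0), (pt 0 1 0); split; try split=> //.
- by apply/eqP => /rowP/(_ 2)/eqP; rewrite ptE mxE oner_eq0.
- by rewrite linevalE !ptE; ring.
- by rewrite linevalE !ptE; ring.
exists (pt 'i 0 0), (pt 1 0 0) => v lv; split.
- by apply: ptP lv; rewrite neq0Ci.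
- by apply: ptP lv; rewrite oner_eq0.
rewrite /formval /C9 /X /Y /Z !(mevalB, mevalM, rmorphXn, mevalXU) (lP _ lv).
rewrite !linevalE !ptE; ring: iE.
Qed.

(** A bitangent without y term is z = 0. *)
Lemma C9_vertical (l : 'rV[algC]_3) : l 0 1 = 0 -> bitangent C9 l ->
  l = l 0 2 *: pt 0 0 1.
Proof.
move=> l1 [p1 [p2 [_ _ _ [m1 [m2 m12]]]]].
suff l0 : l 0 0 = 0 by apply: row3P; rewrite mxE ptE ?l0 ?l1; ring.
apply/eqP; apply: contraT => l0; pose c := - l 0 2 / l 0 0.
(* otherwise the restriction to l has a term y^3 z but no term y^4 *)
pose b1 := m1 0 0 * c + m1 0 2; pose b2 := m2 0 0 * c + m2 0 2.
have sqE y : (m1 0 1 * m2 0 1) ^+ 2 * y ^+ 4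
    + (2%:R * (m1 0 1 * m2 0 1) * (m1 0 1 * b2 + b1 * m2 0 1) - 1) * y ^+ 3
    + ((m1 0 1 * b2 + b1 * m2 0 1) ^+ 2
       + 2%:R * (m1 0 1 * m2 0 1) * (b1 * b2)) * y ^+ 2
    + 2%:R * (m1 0 1 * b2 + b1 * m2 0 1) * (b1 * b2) * y
    + ((b1 * b2) ^+ 2 + c * (c ^+ 3 - 1)) = 0.
  have /m12[_ _] : lineval l (pt c y 1) = 0.
    by rewrite linevalE !ptE l1 /c; field.
  rewrite /formval /C9 /X /Y /Z !(mevalB, mevalM, rmorphXn, mevalXU) !linevalE !ptE.
  move/eqP; rewrite eq_sym -subr_eq0 => /eqP e; rewrite -[RHS]e /b1 /b2; ring.
have [_ _ _ e3 /eqP] := quartic_coef0 sqE.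
rewrite expf_eq0 /= => /eqP A0; move/eqP: e3.
by rewrite A0 mulr0 mul0r sub0r oppr_eq0 oner_eq0.
Qed.

Definition ninthE (V : Type) (e : radexpr V) : radexpr V :=
  RMul (RRat V 16%:R) (RAdd (RAdd (RRat V 94%:R) (RMul (RRat V 12%:R) e))
    (ROpp (RMul (RRat V 33%:R) (rpow e 2)))).

Lemma radeval_ninthE V (env : V -> algC) e :
  radeval env (ninthE e) = ninth (radeval env e).
Proof.
by rewrite /ninthE !(radevalM, radevalD, radevalN, radeval_nat, radeval_rpow).
Qed.

Definition slopeE (V : Type) (a b : nat) : radexpr V :=
  RMul (RRoot 9 (ninthE (nuE V a))) (rpow (rpow (zetaE V) 2) b).

Lemma radeval_slopeE V (env : V -> algC) a b :
  radeval env (slopeE V a b) = slope a b.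
Proof.
rewrite radevalM radeval_root radeval_ninthE radeval_nuE !radeval_rpow.
by rewrite radeval_zetaE.
Qed.

Definition interceptE (V : Type) (a b : nat) : radexpr V :=
  RMul (RMul (ROpp (rpow (RAdd (nuE V a) (RRat V 1)) 2)) (RInv (RRat V 4%:R)))
    (rpow (slopeE V a b) 4).

Lemma radeval_interceptE V (env : V -> algC) a b :
  radeval env (interceptE V a b) = intercept a b.
Proof.
rewrite /interceptE radevalM !radeval_rpow radeval_slopeE radevalM radevalN.
by rewrite !radeval_rpow radevalD radeval_nuE radevalV
  (radeval_nat _ 1) radeval_nat.
Qed.

(** The coefficients of the 28 bitangents: for i < 27, the pair (a, b) is read off
    the Euclidean division of i by 9; the last line is z = 0. *)
Definition C9_coef (i : 'I_28) (j : 'I_3) : radexpr void :=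
  nth (RRat void 0)
    (if (i < 27)%N then
       [:: slopeE void (i %/ 9) (i %% 9); RRat void (-1);
           interceptE void (i %/ 9) (i %% 9)]
     else [:: RRat void 0; RRat void 0; RRat void 1]) j.

Definition C9_line (i : 'I_28) : 'rV[algC]_3 := \row_(j < 3) radval (C9_coef i j).

Lemma C9_lineE (i : 'I_28) : C9_line i =
  if (i < 27)%N then pt (slope (i %/ 9) (i %% 9)) (-1) (intercept (i %/ 9) (i %% 9))
  else pt 0 0 1.
Proof.
have r0 : ratr 0 = 0 :> algC by exact: (rmorph0 (@ratr algC)).
have r1 : ratr 1 = 1 :> algC by exact: (rmorph1 (@ratr algC)).
have rN1 : ratr (- 1) = - 1 :> algC by rewrite rmorphN1.
apply: row3P; rewrite /C9_line mxE /C9_coef /radval; case: ifP => _; rewrite ptE.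
all: by [exact: radeval_slopeE | exact: radeval_interceptE | exact: r0
  | exact: r1 | exact: rN1].
Qed.

Lemma C9_index a b : (a < 3)%N -> (b < 9)%N ->
  exists i : 'I_28, [/\ (i < 27)%N, i %/ 9 = a & i %% 9 = b]%N.
Proof.
move=> lta ltb; have lti : (a * 9 + b < 27)%N.
  rewrite (@leq_trans (a * 9 + 9)) ?ltn_add2l //.
  by rewrite -mulSnr (leq_mul2r 9 a.+1 3) lta.
exists (Ordinal (ltnW lti : (_ < 28)%N)); split=> //=.
- by rewrite divnMDl // divn_small // addn0.
- by rewrite modnMDl modn_small.
Qed.

Lemma slope_inj a b a' b' : (a < 3)%N -> (b < 9)%N -> (a' < 3)%N -> (b' < 9)%N ->
  slope a b = slope a' b' -> intercept a b = intercept a' b' -> a = a' /\ b = b'.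
Proof.
move=> lta ltb lta' ltb' sE iE.
have root_neq0 x : (x < 3)%N -> 9.-root (ninth (nu x)) != 0.
  by move=> ltx; rewrite rootC_eq0 // ninth_neq0 //; apply/nu_roots; exists x.
have s0 : slope a' b' != 0.
  by rewrite mulf_neq0 ?root_neq0 // !expf_neq0 ?zeta_neq0.
have inv x : (x < 3)%N -> (nu x - 2%:R) * (nu x + 1) ^+ 2 = - 1.
  move=> ltx; have v3 : nu x ^+ 3 = 3%:R * nu x + 1 by apply/nu_roots; exists x.
  by ring: v3.
have wE : (nu a + 1) ^+ 2 = (nu a' + 1) ^+ 2.
  apply: (mulIf (expf_neq0 4 s0)); rewrite -{1}sE.
  have qE x y : (nu x + 1) ^+ 2 * slope x y ^+ 4 = - 4%:R * intercept x y.
    by rewrite /intercept; field.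
  by rewrite !qE iE.
have w0 : (nu a' + 1) ^+ 2 != 0.
  apply/eqP => w0; have /eqP := inv _ lta'.
  by rewrite w0 mulr0 eq_sym oppr_eq0 oner_eq0.
have aE : a = a'.
  apply: nu_inj => //; apply: (addIr (- 2%:R)); apply: (mulIf w0).
  by rewrite inv // -wE inv.
split=> //; apply: prim_mul_inj zeta2_prim (root_neq0 _ lta) ltb ltb' _.
by rewrite -/(slope a b) sE aE.
Qed.

Lemma C9_bitangents :
  [/\ forall i, bitangent C9 (C9_line i), distinct_lines C9_line &
      forall l, bitangent C9 l -> exists i, (l == C9_line i)%MS].
Proof.
split=> [i|i j ij|l lB].
- rewrite C9_lineE; case: ifP => [i27|_]; last exact: C9_line_at_infinity.
  apply/C9_graph_bitangentP; rewrite ?ptE ?oppr_eq0 ?oner_eq0 //.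
  exists (i %/ 9)%N, (i %% 9)%N; split; rewrite ?ltn_mod ?ltn_divLR //.
  by rewrite opprK scale1r.
- rewrite !C9_lineE; apply/negP => /same_lineP ijE.
  have pt_neq0 x z : pt x (-1) z != 0.
    by apply/eqP => /rowP/(_ 1)/eqP; rewrite ptE mxE oppr_eq0 oner_eq0.
  case: ifP ijE => i27; case: ifP => j27 ijE.
  + have [c _ cE] := ijE (pt_neq0 _ _).
    have c1 : c = 1.
      by have /rowP/(_ 1) := cE; rewrite scale_pt !ptE mulrN1 => /oppr_inj.
    move: cE; rewrite c1 scale1r => cE.
    have := congr1 (fun u : 'rV[algC]_3 => u 0 0) cE; rewrite !ptE => sE.
    have := congr1 (fun u : 'rV[algC]_3 => u 0 2) cE; rewrite !ptE => tE.
    have [||||aE bE] := slope_inj _ _ _ _ sE tE; rewrite ?ltn_mod ?ltn_divLR //.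
    case/eqP: ij; apply: val_inj.
    by rewrite /= (divn_eq i 9) (divn_eq j 9) aE bE.
  + have [c _ /rowP/(_ 1)/eqP] := ijE (pt_neq0 _ _).
    by rewrite scale_pt !ptE mulr0 oppr_eq0 oner_eq0.
  + have [|c c0 /rowP/(_ 1)/eqP] := ijE.
      by apply/eqP => /rowP/(_ 2)/eqP; rewrite ptE mxE oner_eq0.
    by rewrite scale_pt !ptE mulrN1 eq_sym oppr_eq0 (negPf c0).
  + case/eqP: ij; apply: val_inj => /=.
    have last27 (k : 'I_28) : (k < 27)%N = false -> k = 27 :> nat.
      move=> k27; apply/eqP; rewrite eqn_leq -ltnS ltn_ord /=.
      by rewrite leqNgt k27.
    by rewrite (last27 _ i27) (last27 _ j27).
- have l_neq0 : l != 0 by case: lB => p1 [p2 []].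
  have [l1|l1] := eqVneq (l 0 1) 0.
    exists ord_max; rewrite C9_lineE /= (C9_vertical l1 lB).
    apply: same_line_scale; apply: contraNneq l_neq0 => l2.
    by rewrite (C9_vertical l1 lB) l2 scale0r.
  have /(C9_graph_bitangentP l1)[a [b [lta ltb lE]]] := lB.
  have [i [i27 aE bE]] := C9_index lta ltb; exists i.
  by rewrite C9_lineE i27 aE bE lE same_line_scale // oppr_eq0.
Qed.

(** * Conics meet a line in at most two points *)

(** A homogeneous polynomial of degree 2 in coefficients. *)
Lemma quadratic_formP (Q : {mpoly algC[3]}) : Q \is 2.-homog ->
  exists a b c d e f : algC,
    Q = a%:MP * X ^+ 2 + b%:MP * (X * Y) + c%:MP * Y ^+ 2 + d%:MP * (X * Z)
      + e%:MP * (Y * Z) + f%:MP * Z ^+ 2.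
Proof.
move/dhomogP => Qh; rewrite (mpolyE Q) big_seq.
elim/big_ind: _ => [|P1 P2 [a [b [c [d [e [f ->]]]]]]
  [a' [b' [c' [d' [e' [f' ->]]]]]]|m mQ].
- by exists 0, 0, 0, 0, 0, 0; rewrite !mpolyC0; ring.
- exists (a + a'), (b + b'), (c + c'), (d + d'), (e + e'), (f + f').
  by rewrite !mpolyCD; ring.
have XmE : 'X_[m] = X ^+ m 0 * Y ^+ m 1 * Z ^+ m 2 :> {mpoly algC[3]}.
  rewrite mpolyXE_id !big_ord_recl big_ord0 mulr1 mulrA.
  by congr ('X__ ^+ m _ * 'X__ ^+ m _ * 'X__ ^+ m _); apply: val_inj.
have mE : (m 0%R + m 1%R + m 2%R = 2)%N.
  by have : mdeg m = 2%N := Qh m mQ; rewrite mdegE big_ord3.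
rewrite -mul_mpolyC XmE; set k := Q@_m.
move: (m 0) (m 1) (m 2) mE => [|[|[|m0]]] [|[|[|m1]]] [|[|[|m2]]] //= _.
- by exists 0, 0, 0, 0, 0, k; rewrite !mpolyC0; ring.
- by exists 0, 0, 0, 0, k, 0; rewrite !mpolyC0; ring.
- by exists 0, 0, k, 0, 0, 0; rewrite !mpolyC0; ring.
- by exists 0, 0, 0, k, 0, 0; rewrite !mpolyC0; ring.
- by exists 0, k, 0, 0, 0, 0; rewrite !mpolyC0; ring.
- by exists k, 0, 0, 0, 0, 0; rewrite !mpolyC0; ring.
Qed.

Lemma formval_homog2_scale Q c v : Q \is 2.-homog ->
  formval Q (c *: v) = c ^+ 2 * formval Q v.
Proof.
move=> /quadratic_formP[a [b [c' [d [e [f ->]]]]]].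
rewrite /formval /X /Y /Z !(mevalD, mevalM, rmorphXn, mevalXU, mevalC) !mxE /=.
by ring.
Qed.

Lemma quadratic_coef0 (c2 c1 c0 t0 t1 t2 : algC) :
  t0 != t1 -> t0 != t2 -> t1 != t2 ->
  (forall t, t \in [:: t0; t1; t2] -> c2 * t ^+ 2 + c1 * t + c0 = 0) ->
  [/\ c2 = 0, c1 = 0 & c0 = 0].
Proof.
move=> n01 n02 n12 f0.
have [t01 t02 t12] : [/\ t0 - t1 != 0, t0 - t2 != 0 & t1 - t2 != 0].
  by rewrite !subr_eq0.
have [f0_0 f0_1 f0_2] : [/\ c2 * t0 ^+ 2 + c1 * t0 + c0 = 0,
    c2 * t1 ^+ 2 + c1 * t1 + c0 = 0 & c2 * t2 ^+ 2 + c1 * t2 + c0 = 0].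
  by split; apply: f0; rewrite !inE eqxx ?orbT.
have g01 : c2 * (t0 + t1) + c1 = 0.
  by apply: (mulfI t01); rewrite mulr0 -(subrr 0) -{1}f0_0 -f0_1; ring.
have g02 : c2 * (t0 + t2) + c1 = 0.
  by apply: (mulfI t02); rewrite mulr0 -(subrr 0) -{1}f0_0 -f0_2; ring.
have c20 : c2 = 0.
  by apply: (mulfI t12); rewrite mulr0 -(subrr 0) -{1}g01 -g02; ring.
have c10 : c1 = 0 by rewrite -g01 c20; ring.
by split=> //; rewrite -f0_0 c20 c10; ring.
Qed.

Lemma meval_msize1 (A : {mpoly algC[3]}) u v : (msize A <= 1)%N -> A.@[u] = A.@[v].
Proof. by move/msize1_polyC->; rewrite !mevalC. Qed.

(** No conic passes through three distinct points (x : t : 1) of a vertical line: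
    the quadratic form would be divisible by X - x Z. *)
Lemma conic_collinear (Q : {mpoly algC[3]}) (x t0 t1 t2 : algC) :
  t0 != t1 -> t0 != t2 -> t1 != t2 ->
  (forall t, t \in [:: t0; t1; t2] -> formval Q (pt x t 1) = 0) -> ~ conic Q.
Proof.
move=> t01 t02 t12 f0 [Q0 Qh Qirr].
have [a [b [c [d [e [f QE]]]]]] := quadratic_formP Qh.
have [|cE eE fE] :=
    @quadratic_coef0 c (b * x + e) (a * x ^+ 2 + d * x + f) _ _ _ t01 t02 t12.
  move=> t /f0; rewrite QE /formval /X /Y /Z.
  rewrite !(mevalD, mevalM, rmorphXn, mevalXU, mevalC) !ptE => <-; ring.
(* Q contains the line through the three points *)
pose A : {mpoly algC[3]} := X - x%:MP * Z.
pose B : {mpoly algC[3]} := a%:MP * (X + x%:MP * Z) + b%:MP * Y + d%:MP * Z.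
have QAB : Q = A * B.
  have eE' : e = - (b * x) by apply/eqP; rewrite -addr_eq0 addrC eE.
  have fE' : f = - (a * x ^+ 2 + d * x) by apply/eqP; rewrite -addr_eq0 addrC fE.
  rewrite QE cE eE' fE' /A /B mpolyC0.
  rewrite !(mpolyCN, mpolyCD, mpolyCM, rmorphXn) /=; ring.
have constE (P : {mpoly algC[3]}) v : (msize P <= 1)%N ->
    formval P v = formval P (pt 0 0 0) by exact: meval_msize1.
have [/constE cst|/msize1_polyC cst] := Qirr _ _ QAB.
- move/eqP: (cst (pt 1 0 0)); rewrite /formval /A /X /Z.
  rewrite !(mevalB, mevalM, mevalXU, mevalC) !ptE !mulr0 !subr0.
  by rewrite oner_eq0.
- have B0 : formval B (pt 0 0 0) = 0.
    by rewrite /formval /B /X /Y /Z !(mevalD, mevalM, mevalXU, mevalC) !ptE; ring.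
  case/eqP: Q0; rewrite QAB cst -[_@__](mevalC (fun i => pt 0 0 0 0 i)) -cst.
  by rewrite -/(formval B _) B0 mpolyC0 mulr0.
Qed.

(** * The horizontal bitangents of y^3 z = x (x - z) (x - r z) (x - (1 - r) z) *)

Lemma formval_C6 (r n x z : algC) : formval (C6 r) (pt x (0 * x + n * z) z) =
  - (x ^+ 4 + - 2%:R * x ^+ 3 * z + (1 + r * (1 - r)) * x ^+ 2 * z ^+ 2
     + - (r * (1 - r)) * x * z ^+ 3 + - n ^+ 3 * z ^+ 4).
Proof.
rewrite /formval /C6 /X /Y /Z !(mevalB, mevalM, rmorphXn, mevalXU, mevalZ) !ptE; ring.
Qed.

(** The quartic x^4 - 2 x^3 + (1 + s) x^2 - s x - n^3 equals
    (x^2 - x + s / 2)^2 - (n^3 + s^2 / 4). *)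
Lemma C6_monic_squareP (s n : algC) :
  monic_square (- 2%:R) (1 + s) (- s) (- n ^+ 3) <-> n ^+ 3 = - (s ^+ 2 / 4%:R).
Proof.
split=> [[p [q [e3 e2 e1 e0]]]|n3]; last first.
  by exists (-1), (s / 2%:R); split; rewrite ?n3; field.
have pE : p = -1.
  have -> : p = 2%:R * p / 2%:R by field.
  by rewrite -e3; field.
have qE : q = s / 2%:R.
  have -> : q = (p ^+ 2 + 2%:R * q - p ^+ 2) / 2%:R by field.
  by rewrite -e2 pE; field.
by rewrite -[LHS]opprK e0 qE; field.
Qed.

Lemma C6_horizontal_bitangentP (r b c : algC) :
  r * (1 - r) != 0 -> b != 0 -> c != 0 ->
  bitangent (C6 r) (c *: hline b) <-> b ^+ 3 = 4%:R / (r * (1 - r)) ^+ 2.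
Proof.
rewrite -[hline b]/(pt 0 b 1) scale_pt; set s := r * (1 - r) => s0 b0 c0.
have n3 : (- b^-1) ^+ 3 = - (s ^+ 2 / 4%:R) <-> b ^+ 3 = 4%:R / s ^+ 2.
  rewrite exprNn -signr_odd /= expr1 mulN1r exprVn.
  split=> [/oppr_inj e|->]; last by rewrite invf_div.
  by rewrite -[LHS]invrK e invf_div.
rewrite -n3 -C6_monic_squareP.
apply: (graph_bitangentP (m := 0) _ _ _ (formval_C6 r _)); rewrite ptE.
- by rewrite mulf_neq0.
- by rewrite ptE; ring.
- by rewrite ptE; field.
Qed.

(** For i < 3, the three cube roots of 4 / (r (1 - r))^2, as expressions in r and
    as functions of r. *)
Definition hcoefE (i : nat) : radexpr unit :=
  let r := RVar tt in
  let s := RMul r (RAdd (RRat unit 1) (ROpp r)) in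
  RMul (RRoot 3 (RMul (RRat unit 4%:R) (RInv (rpow s 2))))
    (rpow (rpow (zetaE unit) 6) i).

Definition hcoef (r : algC) (i : nat) : algC := radval_at r (hcoefE i).

Lemma hcoef_def r i :
  hcoef r i = 3.-root (4%:R / (r * (1 - r)) ^+ 2) * (zeta ^+ 6) ^+ i.
Proof.
rewrite /hcoef /radval_at radevalM !radeval_rpow radeval_zetaE radeval_root radevalM.
by rewrite radeval_nat radevalV radeval_rpow radevalM radevalD (radeval_nat _ 1).
Qed.

Lemma hcoef_root_neq0 (r : algC) : r * (1 - r) != 0 ->
  3.-root (4%:R / (r * (1 - r)) ^+ 2) != 0 :> algC.
Proof.
by move=> s0; rewrite rootC_eq0 // mulf_neq0 ?pnatr_eq0 // invr_eq0 expf_neq0.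
Qed.

Lemma hcoef_neq0 r i : r * (1 - r) != 0 -> hcoef r i != 0.
Proof.
move=> s0; rewrite hcoef_def.
by rewrite mulf_neq0 ?hcoef_root_neq0 // !expf_neq0 ?zeta_neq0.
Qed.

Lemma hcoef_cube r b : r * (1 - r) != 0 ->
  b ^+ 3 = 4%:R / (r * (1 - r)) ^+ 2 <-> exists2 i : nat, (i < 3)%N & b = hcoef r i.
Proof.
move=> s0; split=> [bE|[i _ ->]]; last first.
  by rewrite hcoef_def exprMn rootCK // (exprAC (zeta ^+ 6))
    (prim_expr_order zeta6_prim) expr1n mulr1.
have [||i lti ->] := same_power_prim zeta6_prim (x := b)
    (y := 3.-root (4%:R / (r * (1 - r)) ^+ 2)).
- exact: hcoef_root_neq0.
- by rewrite rootCK.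
- by exists i => //; rewrite hcoef_def.
Qed.

Lemma C6_distinct r : r * (1 - r) != 0 ->
  distinct_lines (fun i : 'I_3 => hline (hcoef r i)).
Proof.
move=> s0 i j ij; apply/negP => /same_lineP ijE.
have [|c c0] := ijE; first by apply/eqP => /rowP/(_ 2)/eqP; rewrite !mxE oner_eq0.
rewrite -![hline _]/(pt 0 _ 1) scale_pt => cE.
have := congr1 (fun u : 'rV[algC]_3 => u 0 2) cE; rewrite !ptE mulr1 => c1.
have := congr1 (fun u : 'rV[algC]_3 => u 0 1) cE; rewrite !ptE -c1 mul1r => bE.
case/eqP: ij; apply: val_inj; move: bE; rewrite !hcoef_def.
by apply: prim_mul_inj zeta6_prim _ _ _; rewrite ?hcoef_root_neq0.
Qed.

(** Every zero of F on a bitangent is proportional to one of the two tangency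
    points, so that a quadratic form vanishing at those vanishes there too. *)
Lemma bitangent_at_zero (F Q : {mpoly algC[3]}) l p1 p2 v :
  bitangent_at F l p1 p2 -> Q \is 2.-homog ->
  formval Q p1 = 0 -> formval Q p2 = 0 ->
  lineval l v = 0 -> formval F v = 0 -> formval Q v = 0.
Proof.
case=> _ _ _ [m1 [m2 m12]] Qh Q1 Q2 lv Fv; have [m1P m2P FE] := m12 v lv.
have /eqP : formval F v = 0 := Fv.
rewrite FE expf_eq0 mulf_eq0 /= => /orP[] /eqP.
- by move/m1P/sub_rVP => [c ->]; rewrite formval_homog2_scale // Q1 mulr0.
- by move/m2P/sub_rVP => [c ->]; rewrite formval_homog2_scale // Q2 mulr0.
Qed.

Lemma C6_not_syzygetic r : r * (1 - r) != 0 ->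
  ~ syzygetic (C6 r) (fun i : 'I_3 => hline (hcoef r i)).
Proof.
set s := r * (1 - r) => s0 [LB Ldist [p1 [p2 [pB [Q Qc Q0]]]]].
have b0 i : hcoef r i != 0 by exact: hcoef_neq0.
have [h sE] : exists h : algC, s = 2%:R * h by exists (s / 2%:R); field.
(* the tangency points have x^2 - x + s / 2 = 0, on each of the three lines *)
have [a [a' [aD aM]]] := quad_split (-1) h.
have aE : a * a = a - h.
  by rewrite -aM; have -> : a' = 1 - a; [rewrite opprK in aD; rewrite -aD|]; ring.
pose t (i : 'I_3) := - (hcoef r i)^-1.
have tQ (i : 'I_3) : formval Q (pt a (t i) 1) = 0.
  have [_ Qh _] := Qc; have [Q1 Q2] := Q0 i.
  apply: (bitangent_at_zero (pB i) Qh Q1 Q2).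
    rewrite linevalE -[hline _]/(pt 0 _ 1) !ptE /t mulrN divff //; ring.
  have t3 : t i ^+ 3 = - h ^+ 2.
    have b3 : hcoef r i ^+ 3 = 4%:R / s ^+ 2.
      by apply/hcoef_cube => //; exists (val i); rewrite ?ltn_ord.
    have -> : t i ^+ 3 = - (hcoef r i ^+ 3)^-1 by rewrite /t -exprVn; ring.
    by rewrite b3 invf_div sE; field.
  have -> : t i = 0 * a + t i * 1 by ring.
  by rewrite formval_C6 -/s t3 sE; ring: aE.
have tneq (i j : 'I_3) : i != j -> t i != t j.
  move=> ij; apply: contra (Ldist i j ij) => /eqP /oppr_inj /invr_inj ->.
  by rewrite submx_refl.
apply: (@conic_collinear Q a (t 0) (t 1) (t 2)) Qc; try exact: tneq.
by move=> x; rewrite !inE => /or3P[] /eqP ->.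
Qed.

Lemma C6_horizontal_bitangents r : r * (1 - r) != 0 ->
  let L := fun i : 'I_3 => hline (hcoef r i) in
  [/\ forall i, bitangent (C6 r) (L i) /\ horizontal (L i),
      distinct_lines L,
      forall l : 'rV[algC]_3,
        bitangent (C6 r) l -> horizontal l -> exists i, (l == L i)%MS &
      asyzygetic (C6 r) L].
Proof.
move=> s0 L.
have b0 i : hcoef r i != 0 by exact: hcoef_neq0.
have LB i : bitangent (C6 r) (L i).
  rewrite -[L i]scale1r; apply/C6_horizontal_bitangentP; rewrite ?oner_eq0 //.
  by apply/hcoef_cube => //; exists (val i); rewrite ?ltn_ord.
split.
- by move=> i; split=> //; exists (hcoef r i) => //; rewrite submx_refl.
- exact: C6_distinct.
- move=> l lB [b bn0 /same_lineP lb].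
  have [|c c0 lE] := lb; first by case: lB => p1 [p2 []].
  move: lB; rewrite lE => /C6_horizontal_bitangentP -/(_ s0 bn0 c0).
  move/(hcoef_cube _ s0) => [i lti ->]; exists (Ordinal lti).
  exact: same_line_scale.
- by split=> //; [exact: C6_distinct | exact: C6_not_syzygetic].
Qed.

Theorem theorem1p2 :
  (exists c : 'I_28 -> 'I_3 -> radexpr void,
     let L := fun i : 'I_28 => \row_(j < 3) radval (c i j) in
     [/\ forall i, bitangent C9 (L i),
         distinct_lines L &
         forall l : 'rV[algC]_3, bitangent C9 l -> exists i, (l == L i)%MS])
  /\
  (exists b : 'I_3 -> radexpr unit,
     forall r : algC, uniq [:: 0; 1; r; 1 - r] ->
       let L := fun i : 'I_3 => hline (radval_at r (b i)) in
       [/\ forall i, bitangent (C6 r) (L i) /\ horizontal (L i),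
           distinct_lines L,
           forall l : 'rV[algC]_3,
             bitangent (C6 r) l -> horizontal l -> exists i, (l == L i)%MS &
           asyzygetic (C6 r) L]).
Proof.
split.
  by exists C9_coef; exact: C9_bitangents.
exists (fun i : 'I_3 => hcoefE i) => r.
rewrite /= !inE !negb_or => /and4P[/and3P[_ r0 _] /andP[r1 _] _ _].
have s0 : r * (1 - r) != 0 by rewrite mulf_neq0 ?subr_eq0 // eq_sym.
exact: C6_horizontal_bitangents.
Qed.
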